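(* Let $\mathbb{F}_q$ be a finite field, $\sigma:\mathbb{F}_q\to\mathbb{F}_q$ a ring endomorphism and $\delta:\mathbb{F}_q\to\mathbb{F}_q$ a $\sigma$-derivation. Two non-constant skew polynomials $f,g\in\mathbb{F}_q[x;\sigma,\delta]$ have a common right root in some polynomial ring extension $\tilde{\mathbb{F}}[x;\tilde\sigma,\tilde\delta]$ of $\mathbb{F}_q[x;\sigma,\delta]$ if and only if $R^{\sigma,\delta}_{\mathbb{F}_q}(f,g)=0$.
   Context: For a division ring $\mathbb{F}$ and a non-zero ring endomorphism $\sigma$ of $\mathbb{F}$, a $\sigma$-derivation is an additive map $\delta:\mathbb{F}\to\mathbb{F}$ with $\delta(ab)=\sigma(a)\delta(b)+\delta(a)b$. The skew polynomial ring $\mathbb{F}[x;\sigma,\delta]$ is the set of polynomials $\sum_i a_ix^i$ ($a_i\in\mathbb{F}$) with usual addition and multiplication determined by $xa=\sigma(a)x+\delta(a)$ for $a\in\mathbb{F}$. The right evaluation $f(a)\in\mathbb{F}$ of $f$ at $a\in\mathbb{F}$ is the unique remainder of the right division of $f$ by $x-a$ ($f=q\cdot(x-a)+f(a)$); $a$ is a right root of $f$ if $f(a)=0$. A polynomial ring extension of $\mathbb{F}[x;\sigma,\delta]$ is a skew polynomial ring $\tilde{\mathbb{F}}[x;\tilde\sigma,\tilde\delta]$ over a division ring $\tilde{\mathbb{F}}$ ($\tilde\sigma$ a ring endomorphism of $\tilde{\mathbb{F}}$, $\tilde\delta$ a $\tilde\sigma$-derivation) such that $\mathbb{F}$ is a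 subring of $\tilde{\mathbb{F}}$, $\tilde\sigma|_{\mathbb{F}}=\sigma$ and $\tilde\delta|_{\mathbb{F}}=\delta$. Having a common right root in it means that there is $\alpha\in\tilde{\mathbb{F}}$ with $f(\alpha)=g(\alpha)=0$, evaluations being taken in $\tilde{\mathbb{F}}[x;\tilde\sigma,\tilde\delta]$. Right $(\sigma,\delta)$-resultant: for $f=\sum_{i=0}^m a_ix^i$ and $g=\sum_{j=0}^n b_jx^j$ of degrees $m,n$, the right $(\sigma,\delta)$-Sylvester matrix is the $(m+n)\times(m+n)$ matrix over $\mathbb{F}$ whose rows are, in order, the vectors of left coefficients with respect to $1,x,\dots,x^{m+n-1}$ of $f,xf,\dots,x^{n-1}f,g,xg,\dots,x^{m-1}g$ (products in $\mathbb{F}[x;\sigma,\delta]$). $R^{\sigma,\delta}_{\mathbb{F}}(f,g)$ is its Dieudonné determinant, which over a field such as $\mathbb{F}_q$ is the ordinary determinant. *)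

(* Defs.v *)
From HB Require Import structures.
From mathcomp Require Import all_boot all_order all_algebra.

Set Implicit Arguments.
Unset Strict Implicit.
Unset Printing Implicit Defensive.

Import GRing.Theory.
Local Open Scope ring_scope.

Record skew_derivation (R : nzRingType) (sigma : {rmorphism R -> R}) :=
  SkewDerivation {
    skew_derivation_fun :> {additive R -> R};
    skew_derivationM : forall a b : R,
      skew_derivation_fun (a * b) =
        sigma a * skew_derivation_fun b + skew_derivation_fun a * b
  }.

(* The ring R[x; sigma, delta]: it has the additive group of {poly R}
   (coefficients written on the left of the powers of x), but its product is
   skew_mul below, not the product of {poly R}. *)
Definition skew_poly (R : nzRingType) (sigma : {rmorphism R -> R})
    (delta : skew_derivation sigma) : Type := {poly R}.

Section SkewPolyRing.
Variables (R : nzRingType) (sigma : {rmorphism R -> R}).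
Variable delta : skew_derivation sigma.
Implicit Types (p q r : {poly R}) (a b c : R).

(* Left multiplication by x:
   x * (\sum_i a_i x^i) = \sum_i (sigma a_i x + delta a_i) x^i. *)
Definition skew_mulX p : {poly R} :=
  map_poly sigma p * 'X + map_poly delta p.

Definition skew_mul p q : {poly R} :=
  \sum_(i < size p) p`_i *: iter i skew_mulX q.

Lemma skew_mulXD p q : skew_mulX (p + q) = skew_mulX p + skew_mulX q.
Proof. by rewrite /skew_mulX !raddfD /= mulrDl addrACA. Qed.

Lemma skew_mulX0 : skew_mulX 0 = 0.
Proof. by rewrite /skew_mulX !raddf0 mul0r addr0. Qed.

Lemma skew_mulX_sum (I : Type) (s : seq I) (P : pred I) (F : I -> {poly R}) :
  skew_mulX (\sum_(i <- s | P i) F i) = \sum_(i <- s | P i) skew_mulX (F i).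
Proof. exact: (big_morph _ skew_mulXD skew_mulX0). Qed.

Lemma skew_mulXZ a p :
  skew_mulX (a *: p) = sigma a *: skew_mulX p + delta a *: p.
Proof.
apply/polyP=> i; rewrite /skew_mulX !(coefD, coefZ, coefMX).
rewrite !coef_map /= !coefZ skew_derivationM mulrDr addrA; congr (_ + _ + _).
by case: i => [|i] /=; rewrite ?mulr0 // rmorphM.
Qed.

Lemma skew_derivation1 : delta 1 = 0.
Proof.
have := skew_derivationM delta 1 1; rewrite mulr1 rmorph1 mul1r mulr1.
by move/(congr1 (fun x => x - delta 1)); rewrite addrK subrr.
Qed.

Lemma iter_skew_mulXD i p q :
  iter i skew_mulX (p + q) = iter i skew_mulX p + iter i skew_mulX q.
Proof. by elim: i => //= i ->; rewrite skew_mulXD. Qed.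

Lemma iter_skew_mulX1 i : iter i skew_mulX 1 = 'X^i.
Proof.
elim: i => [|i IH]; first by rewrite expr0.
rewrite iterS IH; apply/polyP=> j.
rewrite /skew_mulX coefD coefMX !coef_map /= !coefXn.
have -> : delta (j == i)%:R = 0.
  by case: (j == i); rewrite ?raddf0 // skew_derivation1.
by rewrite addr0; case: j => [|j] //=; rewrite rmorph_nat.
Qed.

Lemma skew_mul_widen n p q : (size p <= n)%N ->
  skew_mul p q = \sum_(i < n) p`_i *: iter i skew_mulX q.
Proof.
move=> le_pn; rewrite /skew_mul.
rewrite (big_ord_widen n (fun i => p`_i *: iter i skew_mulX q) le_pn).
rewrite big_mkcond /=.
apply: eq_bigr => i _; case: ltnP => // le_pi.
by rewrite nth_default // scale0r.
Qed.

Lemma skew_mulDl : left_distributive skew_mul +%R.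
Proof.
move=> p q r; pose n := maxn (size p) (size q).
rewrite (@skew_mul_widen n (p + q)) ?size_polyD //.
rewrite (@skew_mul_widen n p) ?leq_maxl // (@skew_mul_widen n q) ?leq_maxr //.
by rewrite -big_split; apply: eq_bigr => i _; rewrite coefD scalerDl.
Qed.

Lemma skew_mulDr : right_distributive skew_mul +%R.
Proof.
move=> p q r; rewrite /skew_mul -big_split; apply: eq_bigr => i _.
by rewrite iter_skew_mulXD scalerDr.
Qed.

Lemma skew_mul0p q : skew_mul 0 q = 0.
Proof. by rewrite /skew_mul size_poly0 big_ord0. Qed.

Lemma skew_mulZl a p q : skew_mul (a *: p) q = a *: skew_mul p q.
Proof.
rewrite (@skew_mul_widen (size p)) ?size_scale_leq // /skew_mul scaler_sumr.
by apply: eq_bigr => i _; rewrite coefZ scalerA.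
Qed.

Lemma skew_mul_suml (I : Type) (s : seq I) (P : pred I) (F : I -> {poly R}) q :
  skew_mul (\sum_(i <- s | P i) F i) q = \sum_(i <- s | P i) skew_mul (F i) q.
Proof.
by apply: (big_morph (skew_mul^~ q) _ (skew_mul0p q)) => p r; rewrite skew_mulDl.
Qed.

Lemma skew_mulXn i q : skew_mul 'X^i q = iter i skew_mulX q.
Proof.
rewrite /skew_mul size_polyXn big_ord_recr /= coefXn eqxx scale1r.
by rewrite big1 ?add0r // => j _; rewrite coefXn ltn_eqF // scale0r.
Qed.

Lemma skew_mul_polyX q : skew_mul 'X q = skew_mulX q.
Proof. exact: (skew_mulXn 1 q). Qed.

Lemma skew_mulX_mul p q : skew_mul (skew_mulX p) q = skew_mulX (skew_mul p q).
Proof.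
rewrite -[p]coefK poly_def skew_mulX_sum !skew_mul_suml skew_mulX_sum.
apply: eq_bigr => i _; rewrite skew_mulXZ skew_mulDl !skew_mulZl skew_mulXZ.
by rewrite -iter_skew_mulX1 -iterS !iter_skew_mulX1 !skew_mulXn iterS.
Qed.

Lemma skew_mulA : associative skew_mul.
Proof.
move=> p q r; rewrite {2}/skew_mul skew_mul_suml; apply: eq_bigr => i _.
rewrite skew_mulZl; congr (_ *: _).
by elim: (i : nat) => //= j ->; rewrite skew_mulX_mul.
Qed.

Lemma skew_mul1p : left_id 1 skew_mul.
Proof. by move=> q; rewrite -(expr0 'X) skew_mulXn. Qed.

Lemma skew_mulp1 : right_id 1 skew_mul.
Proof.
move=> p; rewrite -[RHS]coefK poly_def; apply: eq_bigr => i _.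
by rewrite iter_skew_mulX1.
Qed.

HB.instance Definition _ := GRing.Zmodule.copy (skew_poly delta) {poly R}.
HB.instance Definition _ := GRing.Zmodule_isNzRing.Build (skew_poly delta)
  skew_mulA skew_mul1p skew_mulp1 skew_mulDl skew_mulDr (oner_neq0 {poly R}).

Definition skewX : skew_poly delta := 'X.
Definition skewC a : skew_poly delta := a%:P.
Definition skew_coef (f : skew_poly delta) (i : nat) : R := (f : {poly R})`_i.

(* As for size on {poly R}, this is the degree of f for f <> 0. *)
Definition skew_deg (f : skew_poly delta) : nat := (size (f : {poly R})).-1.

Lemma skewXC a : skewX * skewC a = skewC (sigma a) * skewX + skewC (delta a).
Proof.
rewrite /skewX /skewC.
have mulCE b q : (b%:P : skew_poly delta) * q = b *: q.
  change (skew_mul b%:P q = b *: q).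
  by rewrite (@skew_mul_widen 1) ?size_polyC_leq1 // big_ord1 coefC.
rewrite mulCE; change (skew_mul 'X a%:P = sigma a *: 'X + (delta a)%:P).
by rewrite skew_mul_polyX /skew_mulX !map_polyC /= mul_polyC.
Qed.

Lemma skew_polyE (f : skew_poly delta) :
  f = \sum_(i < size (f : {poly R})) skewC (skew_coef f i) * skewX ^+ i.
Proof.
have XnE i : skewX ^+ i = 'X^i :> {poly R}.
  elim: i => [|i IH]; first by rewrite !expr0.
  rewrite exprS; change (skew_mul 'X (skewX ^+ i) = 'X^(i.+1)).
  by rewrite IH skew_mul_polyX -iter_skew_mulX1 -iterS iter_skew_mulX1.
rewrite -[LHS]coefK poly_def; apply: eq_bigr => i _.
change (f`_i *: 'X^i = skew_mul (f`_i)%:P (skewX ^+ i)).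
by rewrite (@skew_mul_widen 1) ?size_polyC_leq1 // big_ord1 coefC XnE.
Qed.

(* c is the right evaluation f(a). *)
Definition is_right_eval (f : skew_poly delta) (a c : R) : Prop :=
  exists q : skew_poly delta, f = q * (skewX - skewC a) + skewC c.

Definition right_root (f : skew_poly delta) (a : R) : Prop :=
  is_right_eval f a 0.

Lemma right_eval_exists (f : skew_poly delta) a : exists c, is_right_eval f a c.
Proof.
have evC c : is_right_eval (skewC c) a c by exists 0; rewrite mul0r add0r.
have evD (p q : skew_poly delta) c d : is_right_eval p a c ->
    is_right_eval q a d -> is_right_eval (p + q) a (c + d).
  case=> [u ->] [v ->]; exists (u + v).
  by rewrite mulrDl addrACA; congr (_ + _); rewrite /skewC polyCD.
have evX (p : skew_poly delta) c : is_right_eval p a c ->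
    is_right_eval (skewX * p) a (sigma c * a + delta c).
  case=> [u ->]; exists (skewX * u + skewC (sigma c)).
  rewrite mulrDr skewXC mulrA mulrDl -!addrA; congr (_ + _).
  rewrite mulrBr -addrA; congr (_ + _).
  have -> : skewC (sigma c * a + delta c)
      = skewC (sigma c) * skewC a + skewC (delta c).
    rewrite {1}/skewC polyCD; congr (_ + _).
    change ((sigma c * a)%:P = skew_mul (sigma c)%:P a%:P).
    rewrite (@skew_mul_widen 1) ?size_polyC_leq1 // big_ord1 coefC /=.
    by rewrite -mul_polyC -polyCM.
  by rewrite addrA addNr add0r.
have evZ (p : skew_poly delta) b c : is_right_eval p a c ->
    is_right_eval (skewC b * p) a (b * c).
  case=> [u ->]; exists (skewC b * u).
  rewrite mulrDr mulrA; congr (_ + _).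
  change (skew_mul b%:P c%:P = (b * c)%:P).
  rewrite (@skew_mul_widen 1) ?size_polyC_leq1 // big_ord1 coefC /=.
  by rewrite -mul_polyC -polyCM.
rewrite [f]skew_polyE; elim/big_rec: _ => [|i p _ [c evp]].
  by exists 0; exact: evC.
have [d evd] : exists d, is_right_eval (skewX ^+ i) a d.
  elim: (i : nat) => [|j [d evd]]; first by exists 1; exact: evC.
  by rewrite exprS; eexists; exact: evX evd.
by eexists; apply: evD evp; exact: evZ evd.
Qed.

Lemma right_eval_unique (f : skew_poly delta) a c d :
  is_right_eval f a c -> is_right_eval f a d -> c = d.
Proof.
pose N := fix N i := if i is j.+1 then sigma (N j) * a + delta (N j) else 1.
pose ev p := \sum_(i < size p) p`_i * N i.
have evE n p : (size p <= n)%N -> ev p = \sum_(i < n) p`_i * N i.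
  move=> le_pn; rewrite /ev (big_ord_widen n (fun i => p`_i * N i) le_pn).
  rewrite big_mkcond /=; apply: eq_bigr => i _; case: ltnP => // le_pi.
  by rewrite nth_default // mul0r.
have evD p q : ev (p + q) = ev p + ev q.
  pose n := maxn (size p) (size q).
  rewrite (evE n (p + q)) ?size_polyD // (evE n p) ?leq_maxl //.
  rewrite (evE n q) ?leq_maxr // -big_split; apply: eq_bigr => i _.
  by rewrite coefD mulrDl.
have evZ b p : ev (b *: p) = b * ev p.
  rewrite (evE (size p)) ?size_scale_leq // /ev mulr_sumr.
  by apply: eq_bigr => i _; rewrite coefZ mulrA.
have ev0 : ev 0 = 0 by rewrite /ev size_poly0 big_ord0.
have evC b : ev b%:P = b.
  by rewrite (evE 1) ?size_polyC_leq1 // big_ord1 coefC mulr1.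
have evXn i : ev 'X^i = N i.
  rewrite /ev size_polyXn big_ord_recr /= coefXn eqxx mul1r.
  by rewrite big1 ?add0r // => j _; rewrite coefXn ltn_eqF // mul0r.
have evT p : ev (skew_mulX p) = sigma (ev p) * a + delta (ev p).
  rewrite -[p]coefK poly_def skew_mulX_sum !(big_morph ev evD ev0).
  rewrite !raddf_sum mulr_suml -big_split; apply: eq_bigr => i _ /=.
  rewrite skew_mulXZ evD !evZ skew_derivationM rmorphM addrA.
  rewrite -iter_skew_mulX1 -iterS !iter_skew_mulX1 !evXn /=.
  by rewrite mulrDr mulrA.
have evM q : ev (skew_mul q ('X - a%:P)) = 0.
  rewrite /skew_mul (big_morph ev evD ev0) big1 // => i _; rewrite evZ.
  suff -> : ev (iter i skew_mulX ('X - a%:P)) = 0 by rewrite mulr0.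
  elim: (i : nat) => [|j IH] /=; last by rewrite evT IH !raddf0 mul0r addr0.
  by rewrite -polyCN evD evC -['X]expr1 evXn /= rmorph1 mul1r skew_derivation1
    addr0 subrr.
have evr e : is_right_eval f a e -> ev f = e.
  case=> q ->; change (ev (skew_mul q ('X - a%:P) + e%:P) = e).
  by rewrite evD evM add0r evC.
by move=> /evr <- /evr <-.
Qed.

(* Rows, in order: f, x f, ..., x^(n-1) f, g, x g, ..., x^(m-1) g. *)
Definition skew_sylvester (f g : skew_poly delta) :
    'M[R]_(skew_deg f + skew_deg g) :=
  \matrix_(i, j)
    skew_coef (if (i < skew_deg g)%N then skewX ^+ i * f
               else skewX ^+ (i - skew_deg g) * g) j.

End SkewPolyRing.

(* Over a commutative ring, hence over a field, the determinant is \det. *)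
Definition skew_resultant (F : fieldType) (sigma : {rmorphism F -> F})
    (delta : skew_derivation sigma) (f g : skew_poly delta) : F :=
  \det (skew_sylvester f g).

Definition division_ring (R : unitRingType) : Prop :=
  forall a : R, a != 0 -> a \is a GRing.unit.

(* ext_inj embeds F in the larger division ring; a ring morphism from a
   division ring to a non-zero ring is injective. *)
Record poly_ring_extension (F : unitRingType) (sigma : {rmorphism F -> F})
    (delta : skew_derivation sigma) := PolyRingExtension {
  ext_ring : unitRingType;
  ext_division_ring : division_ring ext_ring;
  ext_sigma : {rmorphism ext_ring -> ext_ring};
  ext_delta : skew_derivation ext_sigma;
  ext_inj : {rmorphism F -> ext_ring};
  ext_sigmaE : forall a : F, ext_sigma (ext_inj a) = ext_inj (sigma a);
  ext_deltaE : forall a : F, ext_delta (ext_inj a) = ext_inj (delta a)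
}.

Definition ext_poly (F : unitRingType) (sigma : {rmorphism F -> F})
    (delta : skew_derivation sigma) (E : poly_ring_extension delta)
    (f : skew_poly delta) : skew_poly (ext_delta E) :=
  map_poly (ext_inj E) f.

Definition common_right_root_in_extension (F : unitRingType)
    (sigma : {rmorphism F -> F}) (delta : skew_derivation sigma)
    (f g : skew_poly delta) : Prop :=
  exists (E : poly_ring_extension delta) (alpha : ext_ring E),
    right_root (ext_poly E f) alpha /\ right_root (ext_poly E g) alpha.

(* Main.v *)
From HB Require Import structures.
Require Import Defs.
From mathcomp Require Import all_boot all_order all_algebra.
From mathcomp Require Import all_fingroup all_solvable all_field ring.

(* The resultant vanishes iff f and g have a right common factor of positive
   degree: a kernel vector of the Sylvester matrix is a relation k f + l g = 0
   with deg k < deg g, and if 1 = a f + b g then reducing the coefficient p a of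
   f in p = p a f + p b g modulo k puts every p of degree < deg f + deg g in the
   row space. A common root in an extension excludes 1 = u f + v g.
   Conversely, let h have positive degree. An endomorphism of a finite field is
   a power x |-> x^Q of the Frobenius map, and a skew derivation is inner,
   delta a = c (sigma a - a). These formulas also extend sigma and delta to the
   algebraic closure K, where the right evaluation of h at a is the value at a
   of \sum_i h_i N_i with N_0 = 1 and N_(i+1) = N_i^Q (X + c) - c N_i. Since
   the degrees of the N_i increase strictly, this polynomial has a root in K. *)

Set Implicit Arguments.
Unset Strict Implicit.
Unset Printing Implicit Defensive.
Import GRing.Theory.
Local Open Scope ring_scope.

(** * Endomorphisms and skew derivations of a finite field *)

(** If [c] were not among the images of [0, ..., p - 1], then ['X^p - 'X] would have [p + 1]
    distinct roots. *)
Lemma pchar_fixed_nat (F : fieldType) (p : nat) (c : F) :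
  p \in [pchar F] -> c ^+ p = c -> exists n : nat, c = n%:R.
Proof.
move=> chFp cp; have p_gt1 := prime_gt1 (pcharf_prime chFp).
pose s : seq F := [seq n%:R | n <- iota 0 p].
have [/mapP[n _ ->] | c_s] := boolP (c \in s); first by exists n.
have s_inj : {in iota 0 p &, injective (fun n => n%:R : F)}.
  have le_inj m n : (m <= n)%N -> (n < p)%N -> m%:R = n%:R :> F -> m = n.
    move=> le_mn lt_np Emn.
    have: (n - m)%:R = 0 :> F by rewrite natrB // Emn subrr.
    move/eqP; rewrite -(dvdn_pcharf chFp); case: (posnP (n - m)) => [|nm_gt0].
      by move/eqP; rewrite subn_eq0 => le_nm _; apply: anti_leq; rewrite le_mn.
    by move/(dvdn_leq nm_gt0); rewrite leqNgt (leq_ltn_trans (leq_subr _ _)).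
  move=> m n; rewrite !mem_iota /= !add0n => lt_mp lt_np Emn.
  by have [le_mn | /ltnW le_nm] := leqP m n; [|apply/esym]; apply: le_inj.
have szq : size ('X^p - 'X : {poly F}) = p.+1.
  by rewrite size_polyDl ?size_polyXn // size_polyN size_polyX.
have rootq a : root ('X^p - 'X) a = (a ^+ p == a).
  by rewrite /root !hornerE hornerXn subr_eq0.
have q_neq0 : 'X^p - 'X != 0 :> {poly F} by rewrite -size_poly_eq0 szq.
have roots_s : all (root ('X^p - 'X)) (c :: s).
  rewrite /= rootq cp eqxx; apply/allP=> _ /mapP[n _ ->].
  by rewrite rootq -(pFrobenius_autE chFp) pFrobenius_aut_nat.
have uniq_s : uniq (c :: s) by rewrite /= c_s map_inj_in_uniq ?iota_uniq.
have := max_poly_roots q_neq0 roots_s uniq_s.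
by rewrite szq /= size_map size_iota ltnn.
Qed.

(** The unit group is cyclic, so [sigma] is determined by its value at a generator [w], and this
    value is one of the conjugates [w ^+ (p ^ s)]. *)
Lemma finField_endo_Frobenius (F : finFieldType) (sigma : {rmorphism F -> F}) :
  exists p s : nat, p \in [pchar F] /\ forall x, sigma x = x ^+ (p ^ s).
Proof.
have [p p_pr chFp] := finPcharP F; exists p.
have [e cardF] : exists e, #|F| = (p ^ e.+1)%N.
  have := card_pprimeChar chFp; case: (logn _ _) => [|e]; last by exists e.
  by move=> F1; have := finNzRing_gt1 F; rewrite F1.
have /cyclicP[u genu] := field_unit_group_cyclic [set: {unit F}]%G.
pose w := val u.
have powF x : x != 0 -> exists k, x = w ^+ k.
  rewrite -unitfE => Ux.
  have: FinRing.unit F Ux \in <[u]>%g by rewrite -genu inE.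
  by case/cycleP=> k Ek; exists k; rewrite -FinRing.val_unitX -Ek.
(* The coefficients of [f] are fixed by Frobenius, so they lie in the prime
   field and are fixed by [sigma]; hence [sigma w] is a root of [f]. *)
pose f := \prod_(s < e.+1) ('X - (w ^+ (p ^ s))%:P).
(* Frobenius shifts the factors cyclically: the last one becomes the first, because
   [w ^+ #|F| = w]. *)
have fixf : map_poly (pFrobenius_aut chFp) f = f.
  rewrite /f rmorph_prod [RHS]big_ord_recl big_ord_recr mulrC /=; congr (_ * _).
    apply: eq_bigr => s _.
    by rewrite map_polyXsubC /= pFrobenius_autE -exprM -expnSr.
  rewrite map_polyXsubC /= pFrobenius_autE -exprM -expnSr -cardF.
  by rewrite expf_card expr1.
have sigf : map_poly sigma f = f.
  apply/polyP=> i; rewrite coef_map /=.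
  have /(pchar_fixed_nat chFp)[n ->] : f`_i ^+ p = f`_i.
    by rewrite -(pFrobenius_autE chFp) -coef_map fixf.
  by rewrite rmorph_nat.
have [s Ew] : exists s : 'I_e.+1, sigma w = w ^+ (p ^ s).
  have: root f (sigma w).
    rewrite -sigf fmorph_root /f big_ord_recl rootM root_XsubC.
    by rewrite expn0 expr1 eqxx.
  rewrite /root /f horner_prod => /prodf_eq0[s _].
  by rewrite hornerXsubC subr_eq0 => /eqP; exists s.
exists s; split=> // x; have [-> | /powF[k ->]] := eqVneq x 0.
  by rewrite rmorph0 expr0n expn_eq0 -leqn0 leqNgt prime_gt0.
by rewrite rmorphXn Ew -!exprM mulnC.
Qed.

(** Comparing [delta (a * b)] with [delta (b * a)] shows that [delta b / (sigma b - b)] is the same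
    for all [b] with [sigma b != b]. If [sigma] is the identity, [delta] is an ordinary derivation
    and kills every [a = a ^+ #|F|], since [#|F|] vanishes in [F]. *)
Lemma finField_skew_derivation_inner (F : finFieldType)
    (sigma : {rmorphism F -> F}) (delta : skew_derivation sigma) :
  exists c, forall a, delta a = c * (sigma a - a).
Proof.
have comm a b : (sigma a - a) * delta b = (sigma b - b) * delta a.
  have E : delta (a * b) = delta (b * a) by rewrite mulrC.
  rewrite !skew_derivationM in E; apply/eqP; rewrite -subr_eq0.
  by move/eqP: E; rewrite -subr_eq0 => /eqP <-; apply/eqP; ring.
have [/existsP[b nb] | /existsPn sid] := boolP [exists b, sigma b != b].
  exists (delta b / (sigma b - b)) => a.
  have nb0 : sigma b - b != 0 by rewrite subr_eq0.
  by rewrite mulrAC [delta b * _]mulrC comm mulrAC divff ?mul1r.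
have {}sid a : sigma a = a by apply/eqP; rewrite -[_ == _]negbK sid.
have deltaX a n : delta (a ^+ n) = n%:R * (a ^+ n.-1 * delta a).
  elim: n => [|n IH]; first by rewrite expr0 skew_derivation1 mul0r.
  rewrite exprS skew_derivationM sid IH -natr1.
  by case: n {IH} => [|n]; rewrite /= ?exprS; ring.
exists 0 => a; rewrite mul0r -[in LHS](expf_card a) deltaX.
have [p _ chFp] := finPcharP F.
suff /eqP-> : #|F|%:R == 0 :> F by rewrite mul0r.
rewrite -(dvdn_pcharf chFp); have := card_pprimeChar chFp.
case: (logn _ _) => [|e] cardF; last by rewrite cardF expnS dvdn_mulr.
by have := finNzRing_gt1 F; rewrite cardF.
Qed.

(** * Skew polynomials over a ring *)

Section SkewRing.
Variables (R : nzRingType) (sigma : {rmorphism R -> R}).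
Variable delta : skew_derivation sigma.

Lemma skewCE a (p : skew_poly delta) : skewC delta a * p = a *: (p : {poly R}).
Proof.
rewrite -[RHS](congr1 (GRing.scale a) (skew_mul1p delta p)) -skew_mulZl.
by rewrite alg_polyC.
Qed.

Lemma skewXnE i (p : skew_poly delta) :
  skewX delta ^+ i * p = iter i (skew_mulX delta) p.
Proof.
elim: i => [|i IH]; first by rewrite expr0 mul1r.
by rewrite exprS -mulrA IH; exact: skew_mul_polyX.
Qed.

Lemma skewCD a b : skewC delta (a + b) = skewC delta a + skewC delta b.
Proof. exact: polyCD. Qed.

Lemma skewCM a b : skewC delta (a * b) = skewC delta a * skewC delta b.
Proof. by rewrite skewCE /skewC polyCM mul_polyC. Qed.

Lemma size_skew_mulX_leq (p : {poly R}) :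
  (size (skew_mulX delta p) <= (size p).+1)%N.
Proof.
apply: leq_trans (size_polyD _ _) _; rewrite geq_max.
rewrite (leq_trans (size_polyMleq _ _)) ?size_polyX ?addn2 ?ltnS ?size_poly //.
exact: leq_trans (size_poly _ _) _.
Qed.

Lemma size_iter_skew_mulX_leq i (p : {poly R}) :
  (size (iter i (skew_mulX delta) p) <= i + size p)%N.
Proof.
elim: i => //= i IH; rewrite addSn.
exact: leq_trans (size_skew_mulX_leq _) _.
Qed.

(* The right evaluation of [x ^ i] at [a]. *)
Fixpoint skew_norm (a : R) (i : nat) : R :=
  if i is j.+1 then sigma (skew_norm a j) * a + delta (skew_norm a j) else 1.

Lemma is_right_evalD (p q : skew_poly delta) a c d :
  is_right_eval p a c -> is_right_eval q a d -> is_right_eval (p + q) a (c + d).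
Proof.
by case=> [u ->] [v ->]; exists (u + v); rewrite mulrDl addrACA skewCD.
Qed.

Lemma is_right_evalC a c : is_right_eval (skewC delta c) a c.
Proof. by exists 0; rewrite mul0r add0r. Qed.

(** Writing x as (x - a) + a in x c = sigma(c) x + delta(c) isolates the remainder. *)
Lemma is_right_evalX (p : skew_poly delta) a c :
  is_right_eval p a c ->
  is_right_eval (skewX delta * p) a (sigma c * a + delta c).
Proof.
case=> [u ->]; exists (skewX delta * u + skewC delta (sigma c)).
rewrite mulrDr skewXC mulrA mulrDl -!addrA; congr (_ + _).
by rewrite mulrBr skewCD skewCM addrA addrNK.
Qed.

Lemma is_right_evalZ (p : skew_poly delta) a b c :
  is_right_eval p a c -> is_right_eval (skewC delta b * p) a (b * c).
Proof.
by case=> [u ->]; exists (skewC delta b * u); rewrite mulrDr mulrA skewCM.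
Qed.

(** Right evaluation is left linear, so it is determined by the powers of x. This closed formula
    later turns right roots into roots of an ordinary polynomial. *)
Lemma is_right_eval_norm (p : skew_poly delta) a :
  is_right_eval p a
    (\sum_(i < size (p : {poly R})) skew_coef p i * skew_norm a i).
Proof.
rewrite {1}[p]skew_polyE.
elim/big_ind2: _ => [|q c r d evq evr|i _]; first exact: is_right_evalC.
  exact: is_right_evalD.
apply: is_right_evalZ.
elim: (i : nat) => [|j IH] /=; first exact: is_right_evalC.
by rewrite exprS; exact: is_right_evalX.
Qed.

Lemma right_rootP (p : skew_poly delta) a :
  right_root p a <-> exists q, p = q * (skewX delta - skewC delta a).
Proof.
by split=> [] [q ->]; exists q; rewrite [skewC delta 0]raddf0 addr0.
Qed.

Lemma right_root_mull (p q : skew_poly delta) a :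
  right_root p a -> right_root (q * p) a.
Proof.
by case/right_rootP=> r ->; apply/right_rootP; exists (q * r); rewrite mulrA.
Qed.

End SkewRing.

(** * Base change of skew polynomials to an extension *)

Section Extension.
Variables (F : unitRingType) (sigma : {rmorphism F -> F}).
Variables (delta : skew_derivation sigma) (E : poly_ring_extension delta).

Lemma ext_polyD (p q : skew_poly delta) :
  ext_poly E (p + q) = ext_poly E p + ext_poly E q.
Proof. exact: raddfD. Qed.

Lemma ext_poly_mulX (p : {poly F}) :
  map_poly (ext_inj E) (skew_mulX delta p) =
  skew_mulX (ext_delta E) (map_poly (ext_inj E) p).
Proof.
rewrite /skew_mulX rmorphD rmorphM /= map_polyX; congr (_ * _ + _).
  by apply/polyP => i; rewrite !coef_map /= ext_sigmaE.
by apply/polyP => i; rewrite !coef_map /= ext_deltaE.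
Qed.

Lemma ext_polyM (p q : skew_poly delta) :
  ext_poly E (p * q) = ext_poly E p * ext_poly E q.
Proof.
change (map_poly (ext_inj E) (skew_mul delta p q)
  = skew_mul (ext_delta E) (map_poly (ext_inj E) p) (map_poly (ext_inj E) q)).
rewrite [RHS](@skew_mul_widen _ _ _ (size (p : {poly F}))) ?size_poly //.
rewrite /skew_mul rmorph_sum; apply: eq_bigr => i _ /=.
rewrite map_polyZ coef_map; congr (_ *: _).
by elim: (i : nat) => //= j IH; rewrite ext_poly_mulX IH.
Qed.

End Extension.

(** * Skew polynomials over a field and the Sylvester matrix *)

Section SkewField.
Variables (F : fieldType) (sigma : {rmorphism F -> F}).
Variable delta : skew_derivation sigma.
Implicit Types f g h p q : skew_poly delta.

Definition skew_size p := size (p : {poly F}).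

Lemma skew_size_eq0 p : (skew_size p == 0%N) = (p == 0).
Proof. exact: size_poly_eq0. Qed.

(** An endomorphism of a field is injective, so the leading coefficient survives [sigma]. *)
Lemma size_skew_mulX (p : {poly F}) :
  p != 0 -> size (skew_mulX delta p) = (size p).+1.
Proof.
move=> p_neq0; have s_neq0: map_poly sigma p != 0 by rewrite map_poly_eq0.
rewrite size_polyDl size_mulX // size_map_poly // ltnS; exact: size_poly.
Qed.

Lemma iter_skew_mulX_size i (p : {poly F}) : p != 0 ->
  size (iter i (skew_mulX delta) p) = (i + size p)%N.
Proof.
move=> p_neq0; elim: i => //= i IH; rewrite size_skew_mulX ?IH //.
by rewrite -size_poly_eq0 IH addn_eq0 size_poly_eq0 (negPf p_neq0) andbF.
Qed.

(** The summand coming from the leading coefficient of [p] is strictly larger in size than all the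
    others. *)
Lemma skew_size_mul p q : p != 0 -> q != 0 ->
  skew_size (p * q) = (skew_size p + skew_size q).-1.
Proof.
move=> p0 q0; rewrite /skew_size.
have q_gt0 : (0 < size (q : {poly F}))%N by rewrite lt0n size_poly_eq0.
change (size (skew_mul delta p q)
  = (size (p : {poly F}) + size (q : {poly F})).-1).
case Dn: (size (p : {poly F})) => [|n].
  by move/eqP: Dn; rewrite skew_size_eq0 (negPf p0).
rewrite /skew_mul Dn big_ord_recr /= addrC size_polyDl; last first.
  rewrite size_scale; last by rewrite -[n]/(n.+1.-1) -Dn lead_coef_eq0.
  rewrite iter_skew_mulX_size //.
  rewrite -[X in (_ < X)%N](@prednK (n + size (q : {poly F}))); last first.
    by rewrite addn_gt0 q_gt0 orbT.
  rewrite ltnS; apply: leq_trans (size_sum _ _ _) _; apply/bigmax_leqP => i _.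
  apply: leq_trans (size_scale_leq _ _) _.
  apply: leq_trans (size_iter_skew_mulX_leq _ _ _) _.
  by rewrite -ltnS prednK ?ltn_add2r // addn_gt0 q_gt0 orbT.
by rewrite size_scale ?iter_skew_mulX_size // -[n]/(n.+1.-1) -Dn lead_coef_eq0.
Qed.

Lemma skew_mul_eq0 p q : (p * q == 0) = (p == 0) || (q == 0).
Proof.
have [->|p0] := eqVneq p 0; first by rewrite mul0r eqxx.
have [->|q0] := eqVneq q 0; first by rewrite mulr0 eqxx.
rewrite -skew_size_eq0 skew_size_mul //=.
move: p0 q0; rewrite -!skew_size_eq0.
by case: (skew_size p) (skew_size q) => [|m] [|n] //; rewrite addnS.
Qed.

(** The leading term of [f] is cancelled by a left multiple c x^d h; as c acts from the left, no
    preimage under [sigma] has to be taken. *)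
Lemma skew_right_division f h : h != 0 ->
  exists q r, f = q * h + r /\ (skew_size r < skew_size h)%N.
Proof.
move=> h0; have [k] := ubnP (skew_size f); elim: k f => // k IH f lt_fk.
have [lt_fh | le_hf] := ltnP (skew_size f) (skew_size h).
  by exists 0, f; rewrite mul0r add0r.
pose d := (skew_size f - skew_size h)%N.
pose g : {poly F} := iter d (skew_mulX delta) h.
pose c := lead_coef (f : {poly F}) / lead_coef g.
have szg : size g = skew_size f by rewrite /g iter_skew_mulX_size // subnK.
have g_lead : lead_coef g != 0.
  rewrite lead_coef_eq0 -size_poly_eq0 szg.
  by apply: contraNneq h0 => f0; move: le_hf; rewrite f0 leqn0 skew_size_eq0.
have f_gt0 : (0 < skew_size f)%N.
  by apply: leq_trans le_hf; rewrite lt0n skew_size_eq0.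
pose t : skew_poly delta := skewC delta c * skewX delta ^+ d.
have tE : t * h = c *: g by rewrite -mulrA skewXnE skewCE.
have lt_ft : (skew_size (f - t * h)%R < skew_size f)%N.
  rewrite -(ltn_predK f_gt0) ltnS tE; apply/leq_sizeP => j.
  rewrite leq_eqVlt => /predU1P[<-|lt_fj]; rewrite coefB coefZ.
    have -> : g`_(skew_size f).-1 = lead_coef g by rewrite lead_coefE szg.
    by rewrite divfK // lead_coefE subrr.
  have le_fj : (skew_size f <= j)%N by rewrite -(ltn_predK f_gt0).
  by rewrite !nth_default ?szg // mulr0 subr0.
have [q [r [Er lt_r]]] := IH _ (leq_trans lt_ft lt_fk).
exists (q + t), r; split=> //; rewrite mulrDl addrAC -Er.
by rewrite subrK.
Qed.

(** Euclid's algorithm: [h] is a greatest common right divisor. *)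
Lemma skew_bezout f g : exists h a b u v,
  [/\ h = a * f + b * g, f = u * h & g = v * h].
Proof.
have [k] := ubnP (skew_size g); elim: k f g => // k IH f g lt_gk.
have [-> | g0] := eqVneq g 0.
  by exists f, 1, 0, 1, 0; rewrite !mul1r !mul0r addr0.
have [q [r [Ef lt_rg]]] := skew_right_division f g0.
have [h [a [b [u [v [Eh Eg Er]]]]]] := IH g r (leq_trans lt_rg lt_gk).
exists h, b, (a - b * q), (q * u + v), u; split=> //; last first.
  by rewrite mulrDl -mulrA -Eg -Er.
rewrite Ef mulrDr mulrBl mulrA addrC addrA.
by rewrite subrK.
Qed.

(** * The row space of the Sylvester matrix *)

Section Sylvester.
Variables f g : skew_poly delta.
Let m := skew_deg f.
Let n := skew_deg g.

Let row_poly i : skew_poly delta :=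
  if (i < n)%N then skewX delta ^+ i * f else skewX delta ^+ (i - n) * g.

(** The dictionary between matrix and polynomials: the first [n] entries of [w] are the coefficients
    of the cofactor of [f], the last [m] those of the cofactor of [g]. *)
Lemma skew_sylvester_mul (w : 'rV[F]_(m + n)) :
  rVpoly (w *m skew_sylvester f g) =
  (\poly_(i < n) (rVpoly w)`_i : skew_poly delta) * f +
  (\poly_(i < m) (rVpoly w)`_(n + i) : skew_poly delta) * g :> skew_poly delta.
Proof.
have -> : rVpoly (w *m skew_sylvester f g) =
    \sum_(0 <= i < n + m) (rVpoly w)`_i *: (row_poly i : {poly F}).
  rewrite mulmx_sum_row linear_sum (addnC n) big_mkord.
  apply: eq_bigr => i _ /=.
  rewrite linearZ coef_rVpoly_ord /=; congr (_ *: _).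
  have -> : row i (skew_sylvester f g) = poly_rV (row_poly i).
    by apply/rowP=> j; rewrite !mxE /row_poly.
  (* No row is truncated: each row polynomial has size at most [m + n]. *)
  rewrite poly_rV_K // /row_poly.
  case: ltnP => [lt_in | le_ni]; rewrite skewXnE.
    apply: leq_trans (size_iter_skew_mulX_leq _ _ _) _.
    apply: leq_trans (leq_add (leqnn _) (leqSpred _)) _.
    by rewrite addnS -addSn addnC leq_add2l.
  apply: leq_trans (size_iter_skew_mulX_leq _ _ _) _.
  apply: leq_trans (leq_add (leqnn _) (leqSpred _)) _.
  by rewrite addnS -addSn leq_add2r ltn_subLR // (addnC n).
rewrite (@big_cat_nat _ _ _ n) ?leq_addr //=; congr (_ + _).
  rewrite big_mkord -[RHS]/(skew_mul delta (\poly_(i < n) (rVpoly w)`_i) f).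
  rewrite (@skew_mul_widen _ _ _ n) ?size_poly //.
  by apply: eq_bigr => i _; rewrite [in RHS]coef_poly /row_poly ltn_ord skewXnE.
rewrite -{1}[n]add0n big_addn addKn big_mkord.
rewrite -[RHS]/(skew_mul delta (\poly_(i < m) (rVpoly w)`_(n + i)) g).
rewrite (@skew_mul_widen _ _ _ m) ?size_poly //.
apply: eq_bigr => i _; rewrite [in RHS]coef_poly ltn_ord /row_poly.
by rewrite [(i + n)%N]addnC ltnNge leq_addr addKn /= skewXnE.
Qed.

(** An invertible matrix has the coefficient row of 1 in its row space; [0 < m] leaves room for that
    row. *)
Lemma skew_resultant_neq0_bezout : skew_resultant f g != 0 ->
  (0 < m)%N -> exists u v : skew_poly delta, 1 = u * f + v * g.
Proof.
move=> res_neq0 m_gt0; have S_unit : skew_sylvester f g \in unitmx.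
  by rewrite unitmxE unitfE.
have := skew_sylvester_mul (poly_rV 1 *m invmx (skew_sylvester f g)).
rewrite mulmxKV // poly_rV_K => [Euv|]; first by do 2!eexists; exact: Euv.
by rewrite size_poly1 addn_gt0 m_gt0.
Qed.

Lemma skew_resultant_eq0_syzygy : skew_resultant f g = 0 ->
  g != 0 -> exists u v : skew_poly delta,
    [/\ u * f + v * g = 0, u != 0 & (skew_size u <= n)%N].
Proof.
move=> /eqP/det0P[w w_neq0 wS0] g_neq0; have := skew_sylvester_mul w.
rewrite wS0 linear0.
set u : skew_poly delta := \poly_(i < n) _.
set v : skew_poly delta := \poly_(_ < _) _.
move=> Euv; exists u, v; split=> //; last exact: size_poly.
(* If [u] vanishes, so does [v * g], hence [v], hence the whole kernel row [w]. *)
apply: contra_neq w_neq0 => u0.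
have v0 : v = 0.
  move/esym/eqP: Euv; rewrite u0 mul0r add0r skew_mul_eq0 (negPf g_neq0) orbF.
  by move/eqP.
apply/rowP=> i; rewrite mxE -coef_rVpoly_ord.
have [lt_in | le_ni] := ltnP i n.
  by move/polyP: u0 => /(_ i); rewrite coef_poly lt_in coef0.
move/polyP: v0 => /(_ (i - n)%N); rewrite coef_poly ltn_subLR //.
by rewrite (addnC n) ltn_ord subnKC // coef0.
Qed.

(** Applied to the rows of the identity matrix, the hypothesis puts every unit vector in the row
    space. *)
Lemma skew_sylvester_full : (0 < n)%N ->
  (forall p, (skew_size p <= m + n)%N -> exists r s : skew_poly delta,
     [/\ p = r * f + s * g, (skew_size r <= n)%N & (skew_size s <= m)%N]) ->
  skew_resultant f g != 0.
Proof.
move=> n_gt0 span; rewrite -unitfE -unitmxE -row_full_unit -sub1mx.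
apply/row_subP=> i; apply/submxP.
have [r [s [Ep le_rn le_sm]]] := span (rVpoly (row i 1%:M)) (size_poly _ _).
pose W i := if (i < n)%N then (r : {poly F})`_i else (s : {poly F})`_(i - n).
exists (\row_(i < m + n) W i); apply: (can_inj rVpolyK).
rewrite skew_sylvester_mul Ep.
have coefW j : (j < m + n)%N -> (rVpoly (\row_(i < m + n) W i))`_j = W j.
  by move=> lt_j; rewrite (coef_rVpoly_ord _ (Ordinal lt_j)) mxE.
have -> : \poly_(j < n) (rVpoly (\row_(i < m + n) W i))`_j = r.
  apply/polyP=> j; rewrite coef_poly; case: ltnP => [lt_jn | le_nj].
    by rewrite coefW ?(leq_trans lt_jn) ?leq_addl // /W lt_jn.
  by rewrite nth_default ?(leq_trans le_rn).
have -> // : \poly_(j < m) (rVpoly (\row_(i < m + n) W i))`_(n + j) = s.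
apply/polyP=> j; rewrite coef_poly; case: ltnP => [lt_jm | le_mj].
  by rewrite coefW ?(addnC n) ?ltn_add2r // /W ltnNge leq_addl addnK.
by rewrite nth_default ?(leq_trans le_sm).
Qed.

End Sylvester.

(** The greatest common right divisor serves as [h]; were it constant, the Sylvester matrix would be
    invertible. *)
Lemma skew_resultant_eq0_common_factor f g :
  (0 < skew_deg f)%N -> (0 < skew_deg g)%N -> skew_resultant f g = 0 ->
  exists h u v, [/\ (1 < skew_size h)%N, f = u * h & g = v * h].
Proof.
move=> f_gt0 g_gt0 res0.
have szf : skew_size f = (skew_deg f).+1.
  by rewrite prednK // (leq_trans f_gt0) ?leq_pred.
have szg : skew_size g = (skew_deg g).+1.
  by rewrite prednK // (leq_trans g_gt0) ?leq_pred.
have g0 : g != 0 by rewrite -skew_size_eq0 szg.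
have f0 : f != 0 by rewrite -skew_size_eq0 szf.
have [h [a [b [u [v [Eh Ef Eg]]]]]] := skew_bezout f g.
exists h, u, v; split=> //; rewrite ltnNge; apply/negP => le_h1.
have h0 : h != 0 by apply: contraNneq f0 => h0; rewrite Ef h0 mulr0.
have [c c0 Ec] : exists2 c, c != 0 & h = skewC delta c.
  have Ec := size1_polyC le_h1; exists (h : {poly F})`_0; last exact: Ec.
  by apply: contraNneq h0 => c0; rewrite Ec c0.
have {}Eh : 1 = (skewC delta c^-1 * a) * f + (skewC delta c^-1 * b) * g.
  by rewrite -!mulrA -mulrDr -Eh Ec -skewCM mulVf.
have [k [l [Ekl k0 le_kn]]] := skew_resultant_eq0_syzygy res0 g0.
suff: skew_resultant f g != 0 by rewrite res0 eqxx.
apply: skew_sylvester_full => // p le_p.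
(* The syzygy lets one reduce the coefficient of [f] in a Bezout expression of
   [p] modulo [k], which bounds both coefficients. *)
move: (_ * a) (_ * b) Eh => a' b' Eh.
have [q [r [Er lt_rk]]] := skew_right_division (p * a') k0.
pose s := p * b' - q * l.
have Ep : p = r * f + s * g.
  rewrite -[LHS]mulr1 Eh mulrDr !mulrA Er /s mulrBl mulrDl.
  have -> : q * k * f = - (q * l * g).
    by apply/eqP; rewrite -addr_eq0 -!mulrA -mulrDr Ekl mulr0.
  by rewrite -addrA addrC -addrA.
exists r, s; split=> //; first exact: leq_trans (ltnW lt_rk) le_kn.
have [-> | s0] := eqVneq s 0; first by rewrite /skew_size size_poly0.
(* The bound on [s] comes from [s * g = p - r * f], whose two terms have size at most deg f + deg
   g. *)
have : (skew_size (s * g)%R <= skew_deg f + skew_deg g)%N.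
  have -> : s * g = p - r * f by rewrite {1}Ep addrC addKr.
  apply: leq_trans (size_polyD _ _) _; rewrite geq_max le_p size_polyN.
  have [-> | r0] := eqVneq r 0; first by rewrite mul0r size_poly0.
  have := skew_size_mul r0 f0; rewrite /skew_size => ->.
  rewrite -/(skew_size r) -/(skew_size f) szf addnS /= addnC leq_add2l.
  exact: leq_trans (ltnW lt_rk) le_kn.
by rewrite skew_size_mul // szg addnS /= leq_add2r.
Qed.

End SkewField.

(** * Adjoining a right root *)

Section InnerDerivation.
Variables (R : comNzRingType) (sigma : {rmorphism R -> R}) (c : R).

Definition inner_derivation_fun (a : R) : R := c * (sigma a - a).

Fact inner_derivation_is_additive : zmod_morphism inner_derivation_fun.
Proof. by move=> a b; rewrite /inner_derivation_fun rmorphB; ring. Qed.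

HB.instance Definition _ := GRing.isZmodMorphism.Build R R
  inner_derivation_fun inner_derivation_is_additive.

Fact inner_derivationM (a b : R) : inner_derivation_fun (a * b) =
  sigma a * inner_derivation_fun b + inner_derivation_fun a * b.
Proof.
by rewrite /inner_derivation_fun rmorphM; ring.
Qed.

Definition inner_derivation : skew_derivation sigma :=
  SkewDerivation inner_derivationM.

End InnerDerivation.

Section FrobeniusPower.
Variables (R : comNzRingType) (p s : nat) (chRp : p \in [pchar R]).

(* The proof argument is only there for the morphism instances to depend on. *)
Definition Frobenius_power of p \in [pchar R] := fun a : R => a ^+ (p ^ s).
Local Notation Fr := (Frobenius_power chRp).

Fact Frobenius_power_is_additive : zmod_morphism Fr.
Proof.
rewrite /Frobenius_power; elim: s => [|k IH] a b; first by rewrite !expr1.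
by rewrite expnSr !exprM IH -!(pFrobenius_autE chRp) rmorphB.
Qed.

Fact Frobenius_power_is_monoid_morphism : monoid_morphism Fr.
Proof. by split=> [|a b]; rewrite /Frobenius_power ?expr1n ?exprMn. Qed.

HB.instance Definition _ := GRing.isZmodMorphism.Build R R Fr
  Frobenius_power_is_additive.
HB.instance Definition _ := GRing.isMonoidMorphism.Build R R Fr
  Frobenius_power_is_monoid_morphism.

End FrobeniusPower.

(** * Right evaluations of the powers of x as ordinary polynomials in the point *)

Section NormPolynomial.
Variables (K : fieldType) (p s : nat) (chKp : p \in [pchar K]) (c : K).

(** With Q = [p ^ s], this is the recursion N^Q a + c (N^Q - N) of [skew_norm], with a replaced by
    ['X] and the terms in N^Q collected. *)
Fixpoint norm_poly (i : nat) : {poly K} :=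
  if i is j.+1 then norm_poly j ^+ (p ^ s) * ('X + c%:P) - c *: norm_poly j
  else 1.

Lemma horner_norm_poly a i : (norm_poly i).[a] =
  skew_norm (inner_derivation (Frobenius_power s chKp) c) a i.
Proof.
elim: i => [|i IH] /=; first by rewrite hornerC.
by rewrite !hornerE IH /inner_derivation_fun /= /Frobenius_power; ring.
Qed.

(** The degree d becomes [p ^ s] d + 1: the factor ['X + c%:P] makes it grow even when [p ^ s] is
    1. *)
Lemma ltn_size_norm_poly i :
  (size (norm_poly i) < size (norm_poly i.+1))%N.
Proof.
have q_gt0 : (0 < p ^ s)%N by rewrite expn_gt0 prime_gt0 // (pcharf_prime chKp).
have step j :
    norm_poly j != 0 -> (size (norm_poly j) < size (norm_poly j.+1))%N.
  move=> N0; set N := norm_poly j in N0 *.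
  have szM : (size N < size (N ^+ (p ^ s) * ('X + c%:P))%R)%N.
    rewrite size_Mmonic ?monicXaddC ?expf_neq0 // size_XaddC addn2 /=.
    rewrite ltnS (polySpred N0) (polySpred (expf_neq0 (p ^ s) N0)) size_exp.
    by rewrite ltnS leq_pmulr.
  rewrite /= size_polyDl // size_polyN.
  exact: leq_ltn_trans (size_scale_leq _ _) szM.
have N0 : norm_poly i != 0.
  elim: i => [|i /step]; first exact: oner_neq0.
  by rewrite -size_poly_gt0; apply: leq_ltn_trans.
exact: step.
Qed.

(** By the strict growth of sizes, the top term cannot be cancelled, and its index is at least 1. *)
Lemma size_comb_norm_poly n (a : nat -> K) : a n.+1 != 0 ->
  (1 < size (\sum_(i < n.+2) a i *: norm_poly i)%R)%N.
Proof.
move=> an0; have ltN := homo_ltn ltn_trans ltn_size_norm_poly.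
rewrite big_ord_recr /= addrC size_polyDl size_scale //.
  by have := ltN 0%N n.+1 isT; rewrite size_poly1.
apply: leq_ltn_trans (size_sum _ _ _) (leq_ltn_trans _ (ltn_size_norm_poly n)).
apply/bigmax_leqP => i _; apply: leq_trans (size_scale_leq _ _) _.
have : (i <= n)%N by rewrite -ltnS.
by rewrite leq_eqVlt => /predU1P[-> // | lt_in]; apply/ltnW/ltN.
Qed.

End NormPolynomial.

Lemma skew_root_in_extension (F : finFieldType) (sigma : {rmorphism F -> F})
    (delta : skew_derivation sigma) (h : skew_poly delta) :
  (1 < skew_size h)%N ->
  exists (E : poly_ring_extension delta) (alpha : ext_ring E),
    right_root (ext_poly E h) alpha.
Proof.
move=> h_gt1; have [p [s [chFp sigmaE]]] := finField_endo_Frobenius sigma.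
have [c deltaE] := finField_skew_derivation_inner delta.
have [K [iota _]] := countable_algebraic_closure F.
have chKp : p \in [pchar K] by rewrite (fmorph_pchar iota).
pose sigmaK : {rmorphism K -> K} := Frobenius_power s chKp.
pose deltaK := inner_derivation sigmaK (iota c).
have K_div : division_ring K by move=> a; rewrite unitfE.
have sigmaKE a : sigmaK (iota a) = iota (sigma a) by rewrite sigmaE rmorphXn.
have deltaKE a : deltaK (iota a) = iota (delta a).
  by rewrite deltaE rmorphM rmorphB -sigmaKE.
pose E := PolyRingExtension K_div sigmaKE deltaKE.
pose b i := iota (h : {poly F})`_i.
pose P := \sum_(i < skew_size h) b i *: norm_poly p s (iota c) i.
have P_gt1 : (1 < size P)%N.
  have [n szh] : exists n, skew_size h = n.+2.
    by case: (skew_size h) h_gt1 => [|[|n]] // _; exists n.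
  rewrite /P szh.
  apply: (@size_comb_norm_poly _ _ _ chKp _ _ b).
  rewrite /b fmorph_eq0 -[n.+1]/(n.+2.-1) -szh lead_coef_eq0.
  by rewrite -skew_size_eq0 szh.
have [alpha /rootP Pa] := closed_rootP P (negbT (gtn_eqF P_gt1)).
(* The remainder 0 is rewritten as [P.[alpha]] to match the closed formula for right evaluation. *)
exists E, alpha; rewrite /right_root -[X in is_right_eval _ _ X]Pa.
have -> // : P.[alpha] = \sum_(i < size (ext_poly E h : {poly K}))
    skew_coef (ext_poly E h) i * skew_norm deltaK alpha i.
  rewrite (size_map_poly iota) /P horner_sum; apply: eq_bigr => i _.
  by rewrite hornerZ horner_norm_poly /skew_coef coef_map.
exact: is_right_eval_norm.
Qed.

Theorem theorem3p23 (Fq : finFieldType) (sigma : {rmorphism Fq -> Fq})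
    (delta : skew_derivation sigma) (f g : skew_poly delta)
    (hf : (0 < skew_deg f)%N) (hg : (0 < skew_deg g)%N) :
  common_right_root_in_extension f g <-> skew_resultant f g = 0.
Proof.
split=> [[E [alpha [f_alpha g_alpha]]] | res0].
  apply/eqP; apply: contraT => /skew_resultant_neq0_bezout/(_ hf)[u [v Euv]].
  (* Transported to the extension, the Bezout relation makes [alpha] a right root of 1, whose
     remainder is 1; uniqueness of remainders is contradicted. *)
  have ev0 : right_root (1 : skew_poly (ext_delta E)) alpha.
    have <- : ext_poly E 1 = 1 by exact: (rmorph1 (map_poly (ext_inj E))).
    rewrite Euv ext_polyD !ext_polyM /right_root -[0]addr0.
    by apply: is_right_evalD; apply: right_root_mull.
  have := right_eval_unique ev0 (is_right_evalC (ext_delta E) alpha 1).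
  by move/esym/eqP; rewrite oner_eq0.
have [h [u [v [h_gt1 -> ->]]]] := skew_resultant_eq0_common_factor hf hg res0.
have [E [alpha h_alpha]] := skew_root_in_extension h_gt1.
by exists E, alpha; rewrite !ext_polyM; split; apply: right_root_mull.
Qed.
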